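(* Let $\mathbf{b}\in B_\ell$ be any arrival sequence of length $\ell$, and let $\mathrm{t}=\mathrm{t}(\mathbf{b})$ be the number of times $\mathbf{b}$ touches the diagonal. Then the color-blind equivalence class $\mathcal{C}(\mathbf{b})=\{\mathbf{a}\in B_\ell:\vec{r}(\mathbf{a})=\vec{r}(\mathbf{b})\}$ satisfies $$|\mathcal{C}(\mathbf{b})|=2^{\mathrm{t}}.$$
   Context: An arrival sequence of length $\ell$ is a binary string $\mathbf{b}=b_1b_2\cdots b_\ell\in\{0,1\}^\ell$; $B_\ell$ is the set of all of them. Cars $1,2,\dots,\ell$ arrive in order and choose between two initially empty lanes (left and right): if $b_i=0$, car $i$ enters the right lane; if $b_i=1$, car $i$ enters the currently shorter lane, and enters the right lane if both lanes have the same length. The right lane vector $\vec{r}(\mathbf{b})$ is the increasing list of indices $i$ of the cars that enter the right lane. The merging path of $\mathbf{b}$ is the lattice path from $(0,0)$ whose $i$-th step is an up step $(0,1)$ if car $i$ enters the right lane and a right step $(1,0)$ if car $i$ enters the left lane. The number of touches $\mathrm{t}(\mathbf{b})$ is the number of indices $i\in\{1,\dots,\ell\}$ such that the $i$-th step of the merging path starts on the diagonal $x=y$ (equivalently, both lanes have equal length just before car $i$ arrives). For example, $\mathrm{t}(111100)=3$ (indices $1,3,5$) and $\mathrm{t}(001110)=2$ (indices $1,5$); the endpoint of the path after the last step is not counted. *)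

(* Defs.v *)
From mathcomp Require Import all_boot.

Set Implicit Arguments.
Unset Strict Implicit.
Unset Printing Implicit Defensive.

(* An arrival sequence of length l is an l.-tuple bool, with true for 1 and
   false for 0.  Cars are numbered from 1, so the preference of car k.+1 is
   nth false b k. *)

(* The contents (left, right) of the two lanes, in order of arrival. *)
Definition lanes := (seq nat * seq nat)%type.

Definition enters_right (s : lanes) (pref : bool) : bool :=
  if pref then size s.2 <= size s.1 else true.

Definition arrive (s : lanes) (car : nat) (pref : bool) : lanes :=
  if enters_right s pref then (s.1, rcons s.2 car) else (rcons s.1 car, s.2).

(* The lanes after the arrival of cars 1, ..., k. *)
Fixpoint lanes_after (b : seq bool) (k : nat) : lanes :=
  if k is k'.+1 then arrive (lanes_after b k') k'.+1 (nth false b k')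
  else ([::], [::]).

Definition right_lane (b : seq bool) : seq nat := (lanes_after b (size b)).2.

(* The point (x, y) of the merging path reached after k steps. *)
Fixpoint merging_path (b : seq bool) (k : nat) : nat * nat :=
  if k is k'.+1 then
    let: (x, y) := merging_path b k' in
    if k'.+1 \in right_lane b then (x, y.+1) else (x.+1, y)
  else (0, 0).

(* Step i.+1 starts at merging_path b i; the endpoint merging_path b (size b)
   is not counted. *)
Definition touches (l : nat) (b : l.-tuple bool) : nat :=
  #|[set i : 'I_l | (merging_path b i).1 == (merging_path b i).2]|.

Definition color_blind_class (l : nat) (b : l.-tuple bool) :
    {set l.-tuple bool} :=
  [set a : l.-tuple bool | right_lane a == right_lane b].

(* Main.v *)
Require Import Defs.
From mathcomp Require Import all_boot.

(** The right lane is never shorter than the left one.  So a car arriving when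
    the lanes are level goes right whatever its preference, while otherwise its
    lane determines its preference.  Hence the sequences equivalent to [b] are
    those that agree with [b] at every step starting off the diagonal; they
    correspond to the subsets of the set of touches. *)

Definition level (s : lanes) : bool := size s.1 == size s.2.

Lemma enters_rightE (s : lanes) (p : bool) :
  size s.1 <= size s.2 -> enters_right s p = level s || ~~ p.
Proof.
by case: p => les; rewrite /enters_right /level ?orbT ?orbF // eqn_leq les.
Qed.

(** A car goes left only when the left lane is strictly shorter, so that lane can catch up but never
    overtake. *)
Lemma size_lanes_after (b : seq bool) (k : nat) :
  size (lanes_after b k).1 <= size (lanes_after b k).2.
Proof.
elim: k => //= k IHk; rewrite /arrive enters_rightE // /level.
case: ifP => [_ | /norP[neq_s _]]; rewrite /= size_rcons ?ltn_neqAle ?neq_s //.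
exact: leqW.
Qed.

(** Car [j.+1] joins a lane at its own arrival only and never leaves it, so any later right lane
    still records that one decision. *)
Lemma mem_right_lanes_after (b : seq bool) (k j : nat) :
  (j.+1 \in (lanes_after b k).2)
  = (j < k) && enters_right (lanes_after b j) (nth false b j).
Proof.
elim: k => [|k IHk]; first by rewrite in_nil.
rewrite /= /arrive ltnS leq_eqVlt.
case: ifP => right_k; rewrite /= ?mem_rcons ?in_cons ?eqSS IHk;
  by case: eqP => //= ->; rewrite right_k ?ltnn.
Qed.

Lemma merging_path_sizes (b : seq bool) (k : nat) :
  k <= size b ->
  merging_path b k = (size (lanes_after b k).1, size (lanes_after b k).2).
Proof.
elim: k => //= k IHk lt_k_b; rewrite IHk 1?ltnW //.
rewrite mem_right_lanes_after lt_k_b /= /arrive.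
by case: ifP; rewrite /= size_rcons.
Qed.

Lemma touchesE (l : nat) (b : l.-tuple bool) :
  touches b = #|[set i : 'I_l | level (lanes_after b i)]|.
Proof.
apply: eq_card => i; rewrite !inE merging_path_sizes //.
by rewrite size_tuple ltnW.
Qed.

(** The final right lane reveals the choice of every car, and these choices rebuild both lanes at
    each earlier time. *)
Lemma right_lane_lanes_after (a b : seq bool) (k : nat) :
  size a = size b -> right_lane a = right_lane b -> k <= size b ->
  lanes_after a k = lanes_after b k.
Proof.
move=> eq_size eq_right; elim: k => //= k IHk lt_k_b.
have := mem_right_lanes_after a (size a) k.
rewrite -/(right_lane a) eq_right mem_right_lanes_after eq_size lt_k_b /=.
by rewrite /arrive => ->; rewrite IHk // ltnW.
Qed.

(** Testing levelness along [b] alone suffices: equivalent sequences share all intermediate lanes,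
    and agreement off the diagonal forces the same by induction. *)
Lemma color_blindP (l : nat) (a b : l.-tuple bool) :
  reflect (forall i : 'I_l, ~~ level (lanes_after b i) -> tnth a i = tnth b i)
          (a \in color_blind_class b).
Proof.
rewrite inE; apply: (iffP eqP) => [eq_right i /negPf off_i | agree].
  have eq_after k : k <= l -> lanes_after a k = lanes_after b k.
    by move=> le_k; apply: right_lane_lanes_after; rewrite ?size_tuple.
  have := mem_right_lanes_after a l i.
  rewrite eq_after // mem_right_lanes_after ltn_ord /= eq_after 1?ltnW //.
  rewrite !enters_rightE ?size_lanes_after // off_i /= => /negb_inj.
  by rewrite !(tnth_nth false).
suff eq_after k : k <= l -> lanes_after a k = lanes_after b k.
  by rewrite /right_lane !size_tuple eq_after.
elim: k => //= k IHk lt_k; rewrite IHk 1?ltnW // /arrive.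
rewrite !enters_rightE ?size_lanes_after //.
have [//|off_k] := boolP (level (lanes_after b k)).
by have := agree (Ordinal lt_k) off_k; rewrite !(tnth_nth false) => ->.
Qed.

Theorem theorem6p2 (l : nat) (b : l.-tuple bool) :
  #|color_blind_class b| = 2 ^ touches b.
Proof.
rewrite touchesE; set T := [set i : 'I_l | _].
(* [S] selects the touches at which the preference becomes 1; all other steps copy [b]. *)
pose recolor (S : {set 'I_l}) : l.-tuple bool :=
  [tuple if i \in T then i \in S else tnth b i | i < l].
have recolorE S i :
    tnth (recolor S) i = if i \in T then i \in S else tnth b i.
  exact: tnth_mktuple.
(* Elements of [S] outside [T] are ignored by [recolor], hence the restriction to subsets of [T]. *)
have inj_recolor : {in powerset T &, injective recolor}.
  move=> S1 S2; rewrite !powersetE => /subsetP sub1 /subsetP sub2 eqS.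
  apply/setP => i; have := congr1 (fun a => tnth a i) eqS.
  rewrite /= !recolorE; case: ifP => // /negbT notT _.
  by rewrite (contraNF (sub1 i) notT) (contraNF (sub2 i) notT).
rewrite -card_powerset -(card_in_imset inj_recolor); apply: eq_card => a.
apply/color_blindP/imsetP => [agree | [S _ -> i off_i]]; last first.
  by rewrite recolorE inE (negPf off_i).
exists [set i in T | tnth a i].
  by rewrite powersetE; apply/subsetP => i; rewrite inE => /andP[].
apply: eq_from_tnth => i; rewrite recolorE.
have [iT | off_i] := boolP (i \in T); first by rewrite in_set iT.
by apply: agree; rewrite inE in off_i.
Qed.
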